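(* For every finite digraph $G$ with vertex set $V$, the function $J_G:V\times V\to 2^V$ defined by $J_G(u,v)=\{x\in V\mid x \text{ lies on a shortcut-free path from } u \text{ to } v \text{ in } G\}$ is a directed transit function on $V$.
   Context: Digraphs are finite, loopless and simple. A directed path from $u$ to $v$ is a sequence $(x_0=u,x_1,\dots,x_n=v)$ of pairwise distinct vertices with each $(x_{i-1},x_i)$ an edge; $n=0$ (a single vertex, $u=v$) is allowed. A directed path $(x_0,x_1,\dots,x_n)$ in $G$ is shortcut-free if there is no edge $(x_i,x_j)\in E(G)$ with $j>i+1$ (backward edges $(x_i,x_j)$ with $j<i$ are allowed). A directed transit function on a finite set $V$ is a function $R:V\times V\to 2^V$ satisfying (t0) for all $u,v,w\in V$: if $R(u,w)\neq\emptyset$ and $R(w,v)\neq\emptyset$ then $R(u,v)\neq\emptyset$; (t1) for all $u,v\in V$: if $R(u,v)\neq\emptyset$ then $\{u,v\}\subseteq R(u,v)$; (t3) $R(u,u)=\{u\}$ for all $u\in V$. *)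

(* Defs.v *)
From mathcomp Require Import all_boot.

Set Implicit Arguments.
Unset Strict Implicit.
Unset Printing Implicit Defensive.

(* A finite digraph is given by its vertex type V : finType and its edge
   relation E : rel V, which must be irreflexive (no loops); a relation
   excludes parallel edges, while both E x y and E y x may hold. *)

(* The directed path (x_0 = u, x_1, ..., x_n = v) is represented by u and
   p = [:: x_1; ...; x_n]; p = [::] is the one-vertex path. *)
Definition directed_path (V : finType) (E : rel V) (u : V) (p : seq V) (v : V)
    : bool :=
  [&& path E u p, uniq (u :: p) & last u p == v].

Definition shortcut_free (V : finType) (E : rel V) (u : V) (p : seq V) : bool :=
  [forall i : 'I_(size (u :: p)), forall j : 'I_(size (u :: p)),
     (i.+1 < j) ==> ~~ E (nth u (u :: p) i) (nth u (u :: p) j)].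

Definition shortcut_free_path (V : finType) (E : rel V)
    (u : V) (p : seq V) (v : V) : bool :=
  directed_path E u p v && shortcut_free E u p.

(* Vertices of a path are pairwise distinct, so bounding the length of p by
   #|V| loses nothing: see J_P. *)
Definition J (V : finType) (E : rel V) (u v : V) : {set V} :=
  [set x | [exists p : #|V|.-bseq V,
              shortcut_free_path E u p v && (x \in u :: p)]].

Lemma J_P (V : finType) (E : rel V) (u v x : V) :
  reflect (exists2 p : seq V, shortcut_free_path E u p v & x \in u :: p)
          (x \in J E u v).
Proof.
rewrite inE; apply: (iffP existsP) => [[p /andP[sfp xp]]|[p sfp xp]].
  by exists p.
have /andP[/and3P[_ up _] _] := sfp.
have szp : size p <= #|V|.
  by rewrite ltnW // -[(size p).+1]/(size (u :: p)) -(card_uniqP up) max_card.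
by exists (Bseq szp); rewrite /= sfp.
Qed.

Record directed_transit_function (V : finType) (R : V -> V -> {set V}) : Prop :=
  DirectedTransitFunction {
    dtf_t0 : forall u v w : V,
      R u w != set0 -> R w v != set0 -> R u v != set0;
    dtf_t1 : forall u v : V, R u v != set0 -> [set u; v] \subset R u v;
    dtf_t3 : forall u : V, R u u = [set u]
  }.

(* Main.v *)
Require Import Defs.
From mathcomp Require Import all_boot.

(** A shortest walk repeats no vertex and admits no shortcut, so [J E u v] is
    nonempty exactly when [v] is reachable from [u]; (t0) is then the
    transitivity of reachability. For (t3), the only path from [u] to [u]
    without repeated vertices is the one-vertex path. *)

(** Vertex number [j.+1] of the walk [x :: p] is [nth x p j], so the edge jumps from vertex [i] to
    vertex [j.+1] and the entries of [p] between them are cut out; for [i = j] nothing is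
    removed. *)
Lemma path_bypass (T : Type) (e : rel T) (x : T) (p : seq T) (i j : nat) :
  path e x p -> i <= j < size p -> e (nth x (x :: p) i) (nth x p j) ->
  path e x (take i p ++ drop j p) /\
  last x (take i p ++ drop j p) = last x p.
Proof.
move=> ep /andP[le_ij lt_jp] eij.
have lt_ip := leq_ltn_trans le_ij lt_jp.
have last_take : last x (take i p) = nth x (x :: p) i.
  rewrite (last_nth x) size_takel 1?ltnW //.
  by rewrite -[_ :: _]/(take i.+1 (x :: p)) nth_take.
have Dp : drop j p = nth x p j :: drop j.+1 p by exact: drop_nth.
move: (ep); rewrite -{1}(cat_take_drop i p) cat_path => /andP[ep1 _].
move: (ep); rewrite -{1}(cat_take_drop j p) Dp cat_path /= => /and3P[_ _ ep2].
split; first by rewrite cat_path ep1 /= last_take eij.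
by rewrite -[in RHS](cat_take_drop j p) !last_cat Dp.
Qed.

(** Strong induction on length: repetitions are removed first, then a remaining shortcut is
    bypassed, which leaves a strictly shorter walk with the same ends. *)
Lemma path_shortcut_free (V : finType) (E : rel V) (u : V) (p : seq V) :
  path E u p -> exists q, shortcut_free_path E u q (last u p).
Proof.
have [n] := ubnP (size p); elim: n p => // n IHn p lt_pn Ep.
move: lt_pn; case: (shortenP Ep) => q Eq Uq sub_qp lt_pn.
have le_qn : size q <= n.
  by case/andP: Uq => _ Uq; apply: leq_trans (uniq_leq_size Uq sub_qp) lt_pn.
have [sf|] := boolP (shortcut_free E u q).
  by exists q; rewrite /shortcut_free_path /directed_path Eq Uq eqxx.
(* The head of a shortcut cannot have index 0; writing it as [j.+1] matches the indexing of
   [path_bypass]. *)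
move=> /forallPn[i /forallPn[[[|j] lt_jq]]]; rewrite negb_imply negbK //=.
rewrite !ltnS in lt_jq * => /andP[lt_ij Eij].
have le_ij : i <= j < size q by rewrite (ltnW lt_ij).
have [Er <-] := @path_bypass _ _ _ _ _ _ Eq le_ij Eij.
apply: IHn Er; apply: leq_trans le_qn.
(* The new length [i + (size q - j)] is below [size q] because [i < j]. *)
rewrite size_cat size_drop size_takel ?(leq_trans (ltnW lt_ij) (ltnW lt_jq)) //.
by rewrite -[ltnRHS](subnKC (ltnW lt_jq)) ltn_add2r.
Qed.

Lemma J_neq0 (V : finType) (E : rel V) (u v : V) :
  (J E u v != set0) = connect E u v.
Proof.
apply/set0Pn/connectP => [[x /J_P[p /andP[/and3P[Ep _ /eqP lp] _] _]]|[p Ep ->]].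
  by exists p.
have [q sfq] := @path_shortcut_free _ _ _ _ Ep.
by exists u; apply/J_P; exists q; rewrite ?mem_head.
Qed.

Theorem lemma37 (V : finType) (E : rel V) (E_loopless : irreflexive E) :
  directed_transit_function (J E).
Proof.
split=> [u v w|u v|u].
- by rewrite !J_neq0; exact: connect_trans.
- case/set0Pn=> _ /J_P[p sfp _]; have /andP[/and3P[_ _ /eqP lp] _] := sfp.
  apply/subsetP=> x /set2P[]->; apply/J_P; exists p; rewrite ?mem_head //.
  by rewrite -lp mem_last.
- have J_uu x : x \in J E u u -> x = u.
    case/J_P=> -[|y p]; first by move=> _ /[!inE] /eqP.
    case/andP=> /and3P[_ /andP[/negP up _] /eqP lp] _ _.
    by case: up; rewrite -[X in X \in _]lp /= mem_last.
  apply/setP=> x; rewrite inE; apply/idP/eqP=> [/J_uu //|->].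
  (* Some [y] lies in [J E u u] since [u] reaches itself, and [J_uu] forces [y = u]. *)
  have /set0Pn[y Jy] : J E u u != set0 by rewrite J_neq0 connect0.
  by rewrite -{1}(J_uu y Jy).
Qed.
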